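(* Let $r\ge 2$ and $n\ge r$ be integers and let $G$ be a simple graph on $n$ vertices. If $G$ is $K_{r+1}$-free, then $$\rho_r(G)\le \rho_r(T_r(n)),$$ with equality if and only if $G$ is (isomorphic to) the $r$-partite Tur\'an graph $T_r(n)$.
   Context: Graphs are finite, simple and undirected with vertex set $\{1,\dots,n\}$. A $t$-clique is a set of $t$ vertices inducing a complete subgraph; $C_t(G)$ is the set of $t$-cliques of $G$. The $t$-clique tensor of $G$ is the order-$t$, dimension-$n$ tensor $\mathcal{A}(G)=(a_{i_1\cdots i_t})$ with $a_{i_1\cdots i_t}=\frac{1}{(t-1)!}$ if $\{i_1,\dots,i_t\}\in C_t(G)$ (so in particular $i_1,\dots,i_t$ are distinct), and $a_{i_1\cdots i_t}=0$ otherwise. For an order-$m$ dimension-$n$ tensor $\mathcal{A}$ and $x\in\mathbb{C}^n$, $\mathcal{A}x^{m-1}$ is the vector with $i$-th component $\sum_{i_2,\dots,i_m=1}^n a_{ii_2\cdots i_m}x_{i_2}\cdots x_{i_m}$; $\lambda\in\mathbb{C}$ is an eigenvalue if $\mathcal{A}x^{m-1}=\lambda x^{[m-1]}$ for some nonzero $x\in\mathbb{C}^n$, where $x^{[m-1]}=(x_1^{m-1},\dots,x_n^{m-1})^T$. The spectral radius $\rho(\mathcal{A})$ is the maximum modulus of the eigenvalues, and $\rho_t(G):=\rho(\mathcal{A}(G))$ is the $t$-clique spectral radius of $G$ (for $t=2$ it is the adjacency spectral radius). $T_r(n)$ is the complete $r$-partite graph on $n$ vertices with part sizes $n_1\le\dots\le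 n_r$ and $n_r-n_1\le 1$. *)

(* Defs.v *)
From mathcomp Require Import all_boot all_order all_algebra all_fingroup.
From mathcomp Require Import boolp classical_sets reals complex.

Set Implicit Arguments.
Unset Strict Implicit.
Unset Printing Implicit Defensive.

Import Order.TTheory GRing.Theory Num.Theory.

Local Open Scope ring_scope.
Local Open Scope complex_scope.

Record sgraph (n : nat) := SGraph {
  adj :> rel 'I_n;
  adj_sym : symmetric adj;
  adj_irrefl : irreflexive adj }.

Definition cliques n (t : nat) (G : sgraph n) : {set {set 'I_n}} :=
  [set S : {set 'I_n} | (#|S| == t) && [forall u in S, forall v in S, (u != v) ==> G u v]].

Definition clique_free n (t : nat) (G : sgraph n) : Prop :=
  cliques t G = finset.set0.

Definition isomorphic n (G H : sgraph n) : Prop :=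
  exists s : {perm 'I_n}, forall u v, G u v = H (s u) (s v).

Section CompleteMultipartite.
Variables (n : nat) (part : 'I_n -> nat).

Let padj : rel 'I_n := fun u v => part u != part v.

Fact padj_sym : symmetric padj.
Proof. by move=> u v; rewrite /padj eq_sym. Qed.

Fact padj_irrefl : irreflexive padj.
Proof. by move=> u; rewrite /padj eqxx. Qed.

(* The classes of the partition are the fibres of [part]. *)
Definition complete_multipartite : sgraph n := SGraph padj_sym padj_irrefl.

End CompleteMultipartite.

(* T_r(n): the parts are the residue classes mod r; [turan_part_balanced]
   and [turan_part_gt0] below show that their sizes are as required. *)
Definition turan n (r : nat) : sgraph n :=
  complete_multipartite (fun i : 'I_n => i %% r)%N.
Arguments turan : clear implicits.

Lemma turan_partE n r k : (k < r)%N ->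
  #|[set i : 'I_n | (i %% r == k)%N]| = (n %/ r + (k < n %% r))%N.
Proof.
move=> ltkr; have r0 : (0 < r)%N by apply: leq_ltn_trans ltkr.
rewrite -sum1dep_card -(big_mkord (fun i => i %% r == k)%N (fun=> 1%N)).
elim: n => [|n IHn]; first by rewrite big_geq // div0n mod0n.
rewrite big_mkcond big_nat_recr //= -big_mkcond /= IHn.
have -> : (n.+1 = n %/ r * r + (n %% r).+1)%N by rewrite addnS -divn_eq.
rewrite divnMDl // modnMDl.
have := ltn_pmod n r0; move: (n %/ r)%N (n %% r)%N => q m ltmr {IHn}.
rewrite -addnA; have [eq|neq] := eqVneq m.+1 r.
  rewrite eq divnn r0 modnn ltn0 addn0; congr addn.
  by move: ltkr; rewrite -eq ltnS; case: ltngtP.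
rewrite divn_small ?modn_small ?addn0 //; try by rewrite ltn_neqAle neq.
by congr addn; rewrite ltnS; case: ltngtP.
Qed.

Lemma turan_part_balanced n r k l : (k < r)%N -> (l < r)%N ->
  (#|[set i : 'I_n | (i %% r == k)%N]|
    <= #|[set i : 'I_n | (i %% r == l)%N]| + 1)%N.
Proof.
move=> kr lr; rewrite !turan_partE // -addnA leq_add2l.
by case: (_ < _)%N; case: (_ < _)%N.
Qed.

Lemma turan_part_gt0 n r k : (k < r)%N -> (r <= n)%N ->
  (0 < #|[set i : 'I_n | (i %% r == k)%N]|)%N.
Proof.
by move=> kr rn; rewrite turan_partE // addn_gt0 divn_gt0 // ?rn // (leq_ltn_trans _ kr).
Qed.

(* Tensors of order m >= 1: the entry a_{i1 i2 ... im} is [A i1 [tuple i2; ...; im]],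
   so that no cast is needed to separate the first index from the others. *)
Definition tensor (F : Type) (m n : nat) := 'I_n -> (m.-1).-tuple 'I_n -> F.

Section Spectrum.
Variables (R : realType) (m n : nat).
Implicit Types (A : tensor R[i] m n) (x : 'cV[R[i]]_n).

Definition tensor_apply A x : 'cV[R[i]]_n :=
  \col_i \sum_(s : (m.-1).-tuple 'I_n) A i s * \prod_(j <- s) x j 0.

Definition tensor_eigenvalue A (lambda : R[i]) : Prop :=
  exists2 x : 'cV[R[i]]_n, x != 0 &
    tensor_apply A x = \col_i (lambda * x i 0 ^+ m.-1).

Definition eigenvalue_moduli A : set R :=
  [set rho | exists2 lambda, tensor_eigenvalue A lambda & `|lambda| = rho%:C]%classic.

(* The maximum of [eigenvalue_moduli A] (0 if there is none, which cannot
   happen for m >= 2 and n >= 1). *)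
Definition spectral_radius A : R :=
  xget 0 (eigenvalue_moduli A `&` ubound (eigenvalue_moduli A))%classic.

End Spectrum.

Definition clique_tensor (R : realType) n (t : nat) (G : sgraph n) :
    tensor R[i] t n :=
  fun i s => if [set j in i :: s] \in cliques t G then ((t.-1)`!)%:R^-1 else 0.
Arguments clique_tensor R {n} t G.

Definition clique_spectral_radius (R : realType) n (t : nat) (G : sgraph n) : R :=
  spectral_radius (clique_tensor R t G).
Arguments clique_spectral_radius R {n} t G.

(* Main.v *)
(** By symmetry and nonnegativity of the clique tensor, [rho_r(G)] is the maximum
    of [r * sum_C prod_(j in C) x_j], over the [r]-cliques [C], for [x >= 0] with
    [sum_i x_i ^ r = 1].  If [G] is [K_(r+1)]-free, a weighted form of Erdős'
    degree-majorization argument gives a partition of the vertices into [r]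
    classes [V_k] with [sum_C prod_(j in C) x_j <= prod_k (sum_(i in V_k) x_i)].
    The power mean inequality inside each class and AM-GM across the classes then
    give [rho_r(G) ^ r <= (prod_k n_k) ^ (r-1)], where [n_k] counts the vertices
    of [V_k] with [x_i > 0], and this product of integers is largest for balanced
    classes.  Weights constant on the classes show that the Turán graph reaches
    the bound.  In the equality case [x > 0], the classes are balanced, and
    equality in Erdős' argument forces [G] to be complete multipartite. *)

Require Import Defs.
From mathcomp Require Import boolp classical_sets topology normedtype derive realfun exp.
From mathcomp Require Import all_boot all_order all_algebra all_fingroup.
From mathcomp Require Import reals complex ring lra.

Set Implicit Arguments.
Unset Strict Implicit.
Unset Printing Implicit Defensive.

Import Order.TTheory GRing.Theory Num.Theory.

Local Open Scope ring_scope.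

(** * Weighted sums over cliques *)

Definition nbrs n (G : sgraph n) u : {set 'I_n} := [set v | G u v].

(** On [[set: 'I_n]] this is the Lagrangian polynomial of the hypergraph of [t]-cliques. Taking
    [nbrs G u] for [A], one degree lower, gives its partial derivative in [x u]. *)
Definition clique_sum (F : comNzRingType) n (G : sgraph n) (x : 'I_n -> F) t
    (A : {set 'I_n}) :=
  \sum_(S in cliques t G | S \subset A) \prod_(j in S) x j.

Section Cliques.
Variables (n : nat) (G : sgraph n).
Implicit Types (S A : {set 'I_n}) (u v : 'I_n).

Lemma cliqueP t S :
  reflect (#|S| = t /\ {in S &, forall u v, u != v -> G u v}) (S \in cliques t G).
Proof.
rewrite inE; apply: (iffP andP) => -[].
  move=> /eqP St /forall_inP SG; split=> // u v uS vS uv.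
  by move/forall_inP: (SG u uS) => /(_ v vS) /implyP; apply.
move=> St SG; split; first exact/eqP.
apply/forall_inP => u uS; apply/forall_inP => v vS; apply/implyP; exact: SG.
Qed.

Lemma clique_card t S : S \in cliques t G -> #|S| = t.
Proof. by case/cliqueP. Qed.

Lemma sub_nbrs_notin S u : S \subset nbrs G u -> u \notin S.
Proof.
by move=> SG; apply/negP => /(subsetP SG); rewrite inE adj_irrefl.
Qed.

Lemma cliqueU1 t S u :
  S \in cliques t G -> S \subset nbrs G u -> u |: S \in cliques t.+1 G.
Proof.
move=> /cliqueP [St SG] Su; apply/cliqueP; split.
  by rewrite cardsU1 sub_nbrs_notin // St.
move=> v w; rewrite !inE => /predU1P [->|vS] /predU1P [->|wS].
- by rewrite eqxx.
- by move=> _; have := subsetP Su _ wS; rewrite inE.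
- by move=> _; have := subsetP Su _ vS; rewrite inE adj_sym.
- exact: SG.
Qed.

Lemma cliqueD1 t S u : S \in cliques t.+1 G -> u \in S ->
  (S :\ u \in cliques t G) && (S :\ u \subset nbrs G u).
Proof.
move=> /cliqueP [St SG] uS; apply/andP; split.
  apply/cliqueP; split; first by move: St; rewrite (cardsD1 u) uS => -[].
  by move=> v w /setD1P [_ vS] /setD1P [_ wS]; apply: SG.
apply/subsetP => v /setD1P [vu vS]; rewrite inE; apply: SG => //.
by rewrite eq_sym.
Qed.

Lemma cliqueU1E t S u : u \notin S ->
  (u |: S \in cliques t.+1 G) = (S \in cliques t G) && (S \subset nbrs G u).
Proof.
move=> uS; apply/idP/andP => [|[]]; last exact: cliqueU1.
by move/cliqueD1 => /(_ u (setU11 _ _)); rewrite setU1K // => /andP.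
Qed.

Lemma clique_swap t S u w : S \in cliques t G -> u \in S ->
  S :\ u \subset nbrs G w -> w |: S :\ u \in cliques t G.
Proof.
case: t => [/clique_card /eqP|t SG uS Sw].
  by rewrite cards_eq0 => /eqP ->; rewrite inE.
by have /andP [SuG _] := cliqueD1 SG uS; apply: cliqueU1.
Qed.

End Cliques.

Section CliqueSum.
Variables (F : comNzRingType) (n : nat) (G : sgraph n) (x : 'I_n -> F).
Implicit Types (S A U : {set 'I_n}) (u v : 'I_n).

(** Deleting [u] is a bijection from the [t.+1]-cliques of [A] through [u] to the [t]-cliques of its
    link. *)
Lemma clique_sum_link t A u : u \in A ->
  \sum_(S in cliques t.+1 G | (S \subset A) && (u \in S)) \prod_(j in S) x j =
  x u * clique_sum G x t (A :&: nbrs G u).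
Proof.
move=> uA; rewrite /clique_sum mulr_sumr.
rewrite (reindex_onto (fun S => u |: S) (fun S => S :\ u)) /=; last first.
  by move=> S /and3P [_ _ uS]; rewrite setD1K.
apply: eq_big => S.
  case: (boolP (u \in S)) => uS.
    have -> : ((u |: S) :\ u == S) = false.
      by apply/eqP => SE; move: uS; rewrite -SE !inE eqxx.
    rewrite andbF; apply/esym/negP => /andP [_]; rewrite subsetI => /andP [_].
    by move/sub_nbrs_notin; rewrite uS.
  rewrite setU1K // eqxx andbT setU11 andbT cliqueU1E // subUset sub1set uA.
  by rewrite subsetI -!andbA [(_ \subset _) && (S \subset A)]andbC.
move=> /andP [_ /eqP SE]; rewrite big_setU1 //.
by rewrite -SE !inE eqxx.
Qed.

(** Both sides run over the pairs of a clique [S] and a vertex [u] of [S :&: U]. *)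
Lemma clique_sum_double_count t A U : U \subset A ->
  \sum_(u in U) x u * clique_sum G x t (A :&: nbrs G u) =
  \sum_(S in cliques t.+1 G | S \subset A) #|S :&: U|%:R * \prod_(j in S) x j.
Proof.
move=> UA.
under eq_bigr => u uU do
  rewrite -clique_sum_link ?(subsetP UA) // big_mkcond.
rewrite exchange_big [RHS]big_mkcond; apply: eq_bigr => S _ /=.
case: ifP => [SA|/negP SA]; last first.
  by rewrite big1 // => u _; case: ifP => // /and3P [S1 S2]; case: SA; rewrite S1 S2.
have [S1 S2] := andP SA; rewrite S1 S2 /= -big_mkcondr /=.
rewrite sumr_const mulr_natl; congr (_ *+ _).
by apply: eq_card => u; rewrite !inE andbC.
Qed.

(** Exhibits the sum as affine in [x u], so that a single weight can be varied. *)
Lemma clique_sum_split t A u : u \in A ->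
  clique_sum G x t.+1 A =
  x u * clique_sum G x t (A :&: nbrs G u) + clique_sum G x t.+1 (A :\ u).
Proof.
move=> uA; rewrite -clique_sum_link // /clique_sum.
rewrite (bigID (fun S => u \in S)) /=; congr (_ + _); apply: eq_bigl => S.
  by rewrite -andbA.
by rewrite subsetD1 andbA.
Qed.

Lemma eq_clique_sum t A (y : 'I_n -> F) : {in A, x =1 y} ->
  clique_sum G x t A = clique_sum G y t A.
Proof.
move=> xy; apply: eq_bigr => S /andP [_ SA]; apply: eq_bigr => j jS.
by apply: xy; apply: (subsetP SA).
Qed.

(** Euler's identity for a homogeneous polynomial of degree [t.+1]. *)
Lemma clique_sum_euler t :
  \sum_u x u * clique_sum G x t (nbrs G u) = t.+1%:R * clique_sum G x t.+1 [set: 'I_n].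
Proof.
have := @clique_sum_double_count t [set: 'I_n] [set: 'I_n] (subxx _).
under eq_bigr => u _ do rewrite setTI.
rewrite (eq_bigl xpredT) => [->|u]; last by rewrite inE.
rewrite /clique_sum mulr_sumr; apply: eq_bigr => S /andP [/clique_card + _].
by rewrite setIT => ->.
Qed.

End CliqueSum.

Section CliqueSumOrder.
Variables (R : realFieldType) (n : nat) (G : sgraph n) (x : 'I_n -> R).
Hypothesis x_ge0 : forall i, 0 <= x i.
Implicit Types (S A U : {set 'I_n}) (u v : 'I_n).

Lemma clique_sum_ge0 t A : 0 <= clique_sum G x t A.
Proof. by apply: sumr_ge0 => S _; apply: prodr_ge0. Qed.

Lemma clique_sum_gt0_clique t A : 0 < clique_sum G x t A ->
  exists2 S, S \in cliques t G & S \subset A.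
Proof.
move=> W0; case: (pickP (fun S => (S \in cliques t G) && (S \subset A))).
  by move=> S /andP [S1 S2]; exists S.
by move=> no; move: W0; rewrite /clique_sum big_pred0 ?ltxx.
Qed.

Lemma clique_sum_lt t A (B : {set 'I_n}) S :
  (forall i, 0 < x i) -> A \subset B ->
  S \in cliques t G -> S \subset B -> ~~ (S \subset A) ->
  clique_sum G x t A < clique_sum G x t B.
Proof.
move=> x_gt0 AB SG SB SA.
rewrite /clique_sum [ltRHS](bigID (fun S => S \subset A)) /=.
rewrite [X in _ < X + _](eq_bigl (fun S => (S \in cliques t G) && (S \subset A))); last first.
  move=> S' /=; rewrite -andbA; congr (_ && _).
  by apply/andP/idP => [[]|SA'] //; split=> //; apply: subset_trans AB.
rewrite ltrDl (bigD1 S) ?SG ?SB //= ltr_pwDl ?prodr_gt0 //.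
by apply: sumr_ge0 => S' _; apply: prodr_ge0.
Qed.

End CliqueSumOrder.

(* Erdős' degree-majorization argument, with products of vertex weights in
   place of degrees: a vertex [v] whose link has the largest weight is grouped
   with its non-neighbours, and the induction proceeds inside [nbrs G v]. *)
Lemma erdos_partition (R : realFieldType) n (G : sgraph n) (x : 'I_n -> R) r
    (A : {set 'I_n}) :
  (forall i, 0 <= x i) ->
  (forall S, S \in cliques r.+1 G -> ~~ (S \subset A)) ->
  exists p : 'I_n -> nat,
  [/\ {in A, forall v, (p v < r)%N},
      clique_sum G x r A <= \prod_(k < r) \sum_(i in A | p i == k) x i &
      (forall i, 0 < x i) -> 0 < clique_sum G x r A ->
      clique_sum G x r A = \prod_(k < r) \sum_(i in A | p i == k) x i ->
      {in A &, forall u v, G u v = (p u != p v)}].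
Proof.
move=> x_ge0; elim: r A => [|r IHr] A Afree.
  (* Without 1-cliques [A] is empty; the empty clique and the empty product both give 1. *)
  have A0 v : v \in A -> False.
    move=> vA; suff /Afree : [set v] \in cliques 1 G by rewrite sub1set vA.
    apply/cliqueP; split=> [|u w]; first by rewrite cards1.
    by rewrite !inE => /eqP -> /eqP ->; rewrite eqxx.
  exists (fun=> 0%N); split=> [v /A0 //||_ _ _ u v /A0 //].
  rewrite big_ord0 /clique_sum (bigD1 finset.set0) /=; last first.
    by rewrite sub0set andbT; apply/cliqueP; split=> [|u v]; rewrite ?cards0 // inE.
  rewrite big_set0 big1 ?addr0 // => S /andP [/andP [/clique_card /eqP]].
  by rewrite cards_eq0 => ->.
have [A0|[v0 v0A]] := set_0Vmem A.
  have W0 : clique_sum G x r.+1 A = 0.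
    apply: big_pred0 => S; apply/negP => /andP [/clique_card] + SA.
    by move: SA; rewrite A0 subset0 => /eqP ->; rewrite cards0.
  exists (fun=> 0%N); rewrite W0; split=> [v|| _]; rewrite ?ltxx //.
  by apply: prodr_ge0 => k _; apply: sumr_ge0.
(* The weight of the link takes the place of the degree. *)
pose d u := clique_sum G x r (A :&: nbrs G u).
have [v vA dmax] : exists2 v, v \in A & {in A, forall u, d u <= d v}.
  case: (@Order.TotalTheory.arg_maxP _ _ _ v0 (mem A) d v0A) => v vA dv.
  by exists v.
pose B := A :&: nbrs G v; pose U := A :\: B.
have UA : U \subset A by rewrite subsetDl.
have vU : v \in U by rewrite !inE vA adj_irrefl.
have Bfree S : S \in cliques r.+1 G -> ~~ (S \subset B).
  move=> SG; apply/negP; rewrite subsetI => /andP [SA Sv].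
  by have /Afree := cliqueU1 SG Sv; rewrite subUset sub1set vA SA.
have [p [pB Wp eqW]] := IHr B Bfree.
(* The non-neighbours of [v] in [A], with [v] itself, form the new class [r]. *)
pose q u := if u \in B then p u else r.
have qB u : u \in B -> q u = p u by rewrite /q => ->.
have qU u : u \in U -> q u = r by rewrite /q inE => /andP [/negPf ->].
have prodE : \prod_(k < r.+1) \sum_(i in A | q i == k) x i =
    (\prod_(k < r) \sum_(i in B | p i == k) x i) * \sum_(i in U) x i.
  rewrite big_ord_recr /=; congr (_ * _).
    apply: eq_bigr => k _; apply: eq_bigl => i.
    rewrite /q; case: (boolP (i \in B)) => [iB|_]; first by rewrite (subsetP _ _ iB) ?subsetIl.
    by apply/negP => /andP [_ /eqP rk]; have := ltn_ord k; rewrite -rk ltnn.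
  apply: eq_bigl => i; rewrite /q [in RHS]inE.
  case: (boolP (i \in B)) => [iB|_]; last by rewrite eqxx andbT.
  by apply/negP => /andP [_ /eqP pr]; have := pB i iB; rewrite pr ltnn.
(* A clique avoiding [U] would be an [r.+1]-clique of [B], so the sum over [U] counts every clique
   at least once. *)
have meetU S : S \in cliques r.+1 G -> S \subset A -> (0 < #|S :&: U|)%N.
  move=> SG SA; rewrite card_gt0; apply: contraNneq (Bfree S SG) => SU.
  by rewrite /U setIDA (setIidPl SA) in SU; rewrite -finset.setD_eq0 SU.
have W_le : clique_sum G x r.+1 A <= \sum_(u in U) x u * d u.
  rewrite clique_sum_double_count //; apply: ler_sum => S /andP [SG SA].
  by rewrite ler_peMl ?prodr_ge0 // ler1n meetU.
have d_le : \sum_(u in U) x u * d u <= \sum_(u in U) x u * d v.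
  apply: ler_sum => u uU; rewrite ler_wpM2l ?dmax //; exact: (subsetP UA).
have dp_le : \sum_(u in U) x u * d v <=
    \prod_(k < r.+1) \sum_(i in A | q i == k) x i.
  by rewrite -mulr_suml prodE mulrC ler_wpM2r // sumr_ge0.
exists q; split.
- by move=> u uA; rewrite /q; case: ifP => // uB; rewrite ltnW // ltnS pB.
- exact: le_trans W_le (le_trans d_le dp_le).
move=> x_gt0 W_gt0 WE.
(* Equality between the two ends turns each link of the chain into an equality. *)
have W_eq : clique_sum G x r.+1 A = \sum_(u in U) x u * d u.
  by apply/le_anti; rewrite W_le WE (le_trans d_le).
have d_eq : \sum_(u in U) x u * d u = \sum_(u in U) x u * d v.
  by apply/le_anti; rewrite d_le -W_eq WE.
have dp_eq : \sum_(u in U) x u * d v = \prod_(k < r.+1) \sum_(i in A | q i == k) x i.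
  by apply/le_anti; rewrite dp_le -d_eq -W_eq WE lexx.
have xU_gt0 : 0 < \sum_(u in U) x u.
  by rewrite (bigD1 v) //= ltr_pwDl ?x_gt0 // sumr_ge0.
have dv_gt0 : 0 < d v.
  by rewrite -(pmulr_rgt0 _ xU_gt0) mulr_suml -d_eq -W_eq.
have GB : {in B &, forall u w, G u w = (p u != p w)}.
  apply: eqW => //; apply: (mulfI (lt0r_neq0 xU_gt0)).
  by rewrite mulr_suml dp_eq prodE mulrC.
(* As the weights are positive, equal sums of dominated terms force equal terms. *)
have dU u : u \in U -> d u = d v.
  move=> uU; apply: (mulfI (lt0r_neq0 (x_gt0 u))); apply/eqP.
  have /leif_sum : forall w, w \in U -> x w * d w <= x w * d v ?= iff (x w * d w == x w * d v).
    by move=> w wU; split=> //; rewrite ler_wpM2l ?dmax // (subsetP UA).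
  by case=> _; rewrite d_eq eqxx => /esym/forall_inP; apply.
(* By the same principle, the sum over [U] counts no clique twice. *)
have oneU S : S \in cliques r.+1 G -> S \subset A -> #|S :&: U| = 1%N.
  move=> SG SA.
  have /leif_sum : forall T, (T \in cliques r.+1 G) && (T \subset A) ->
      \prod_(j in T) x j <= #|T :&: U|%:R * \prod_(j in T) x j
      ?= iff (#|T :&: U| == 1)%N.
    move=> T /andP [TG TA]; split; first by rewrite ler_peMl ?prodr_ge0 // ler1n meetU.
    rewrite -subr_eq0 -{1}[\prod_(j in T) x j]mul1r -mulrBl mulf_eq0.
    rewrite [_ == 0 :> R in X in _ || X]gt_eqF ?prodr_gt0 // orbF subr_eq0.
    by rewrite eq_sym pnatr_eq1.
  case=> _; rewrite -clique_sum_double_count // -W_eq eqxx => /esym/forall_inP.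
  by move=> /(_ S); rewrite SG SA => /(_ isT)/eqP.
have [K0 K0G K0B] := clique_sum_gt0_clique dv_gt0.
(* Since [B] is complete multipartite, [w] can replace a vertex [k] of [K0] in its own class. If
   there were no such [k], adding [w] to [K0] would give a forbidden clique. *)
have cliqueB w : w \in B -> exists K, [/\ K \in cliques r G, K \subset B & w \in K].
  move=> wB; case: (pickP (fun k => (k \in K0) && ~~ G w k)) => [k /andP [kK0 wk]|nok].
    exists (w |: K0 :\ k); split; rewrite ?setU11 //; last first.
      by rewrite subUset sub1set wB (subset_trans (subD1set _ _)).
    apply: clique_swap => //; apply/subsetP => j /setD1P [jk jK0]; rewrite inE.
    have kB := subsetP K0B _ kK0; have jB := subsetP K0B _ jK0.
    have [_ /(_ j k jK0 kK0 jk)] := cliqueP _ _ _ K0G.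
    by rewrite !GB // in wk *; move: wk; rewrite negbK => /eqP ->; rewrite eq_sym.
  have : w |: K0 \in cliques r.+1 G.
    apply: cliqueU1 => //; apply/subsetP => k kK0; rewrite inE.
    by have := nok k; rewrite kK0 => /negbFE.
  by move/Bfree; rewrite subUset sub1set wB K0B.
(* If [u] missed [w], the link of [u] would lose the clique [K] of [B] through [w]. All [r]-cliques
   of that link lie in [B], because [u |: S] meets [U] only in [u]; hence [d u < d v]. *)
have UB u w : u \in U -> w \in B -> G u w.
  move=> uU wB; have [K [KG KB wK]] := cliqueB w wB.
  apply: contraT => Guw; suff : d u < d v by rewrite dU // ltxx.
  have uA := subsetP UA _ uU.
  suff -> : d u = clique_sum G x r (B :&: nbrs G u).
    apply: (clique_sum_lt x_ge0 x_gt0 (subsetIl _ _) KG KB).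
    apply: contra Guw => /subsetP /(_ w wK); rewrite !inE => /andP [] //.
  apply: eq_bigl => S; apply: andb_id2l => SG; rewrite !subsetI.
  case: (boolP (S \subset nbrs G u)) => [Su|]; last by rewrite !andbF.
  rewrite !andbT; apply/idP/idP => [SA|/andP [] //].
  have SuA : u |: S \subset A by rewrite subUset sub1set uA SA.
  have /eqP /cards1P [z zE] := oneU _ (cliqueU1 SG Su) SuA.
  have uz : u = z by apply/set1P; rewrite -zE !inE eqxx /=; move: uU; rewrite !inE.
  rewrite SA; apply/subsetP => j jS.
  have ju : j != u by apply: contraNneq (sub_nbrs_notin Su) => <-.
  have jA := subsetP SA _ jS.
  apply: contraNT ju => jv; rewrite uz -in_set1 -zE !inE jS orbT jA andbT /=.
  by move: jv; rewrite !inE.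
move=> u w uA wA.
have inU z : z \in A -> z \notin B -> z \in U by rewrite in_setD => -> ->.
case: (boolP (u \in B)) (boolP (w \in B)) => [uB|/(inU _ uA) uU] [wB|/(inU _ wA) wU].
- by rewrite !qB // GB.
- rewrite adj_sym UB // (qB u uB) (qU w wU); apply/esym.
  by apply: contraTneq (pB u uB) => ->; rewrite ltnn.
- rewrite UB // (qB w wB) (qU u uU); apply/esym.
  by apply: contraTneq (pB w wB) => <-; rewrite ltnn.
(* Two adjacent vertices of [U] would extend [K0] to an [r.+2]-clique of [A]. *)
rewrite !qU // eqxx; apply/negP => Guw.
have K0w : K0 \subset nbrs G w.
  by apply/subsetP => k kK0; rewrite inE UB // (subsetP K0B).
have K0u : K0 \subset nbrs G u.
  by apply/subsetP => k kK0; rewrite inE UB // (subsetP K0B).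
have /Afree : u |: (w |: K0) \in cliques r.+2 G.
  by rewrite !cliqueU1 // subUset sub1set inE Guw.
rewrite !subUset !sub1set uA wA /=.
by rewrite (subset_trans K0B) // subsetIl.
Qed.

(** * Power means and balanced partitions *)

Section PowerMean.
Variable R : realFieldType.
Implicit Types (y m : R) (k : nat).

(** A convex power lies above its tangent at [m]; each inductive step gains a nonnegative multiple
    of [(y - m) ^+ 2]. *)
Lemma expr_tangent_le y m k : 0 <= y -> 0 <= m ->
  m ^+ k.+1 + k.+1%:R * m ^+ k * (y - m) <= y ^+ k.+1.
Proof.
move=> y0 m0; elim: k => [|k IHk]; first by rewrite !expr1 expr0 !mul1r addrC subrK.
apply: le_trans (_ : y * (m ^+ k.+1 + k.+1%:R * m ^+ k * (y - m)) <= _); last first.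
  by rewrite [leRHS]exprS ler_wpM2l.
rewrite -subr_ge0.
have -> : y * (m ^+ k.+1 + k.+1%:R * m ^+ k * (y - m)) -
    (m ^+ k.+2 + k.+2%:R * m ^+ k.+1 * (y - m)) = k.+1%:R * m ^+ k * (y - m) ^+ 2.
  by rewrite !exprS; ring.
by rewrite mulr_ge0 ?sqr_ge0 // mulr_ge0 ?ler0n ?exprn_ge0.
Qed.

(** Strict convexity, hence an exponent at least 2. Multiplying the tangent bound one degree lower
    by [y] shows that [k.+1%:R * m ^+ k * (y - m) ^+ 2] is at most 0; the case [m = 0] is apart
    because this coefficient may vanish. *)
Lemma expr_tangent_eq y m k : 0 <= y -> 0 <= m ->
  y ^+ k.+2 = m ^+ k.+2 + k.+2%:R * m ^+ k.+1 * (y - m) -> y = m.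
Proof.
move=> y0 m0 yE; have [m_eq0|mN0] := eqVneq m 0.
  move: yE; rewrite m_eq0 expr0n /= expr0n /= mulr0 mul0r addr0.
  by move/eqP; rewrite expf_eq0 => /andP [_ /eqP].
have := ler_wpM2l y0 (expr_tangent_le k y0 m0).
rewrite -exprS yE -subr_ge0.
have -> : m ^+ k.+2 + k.+2%:R * m ^+ k.+1 * (y - m) -
    y * (m ^+ k.+1 + k.+1%:R * m ^+ k * (y - m)) = - (k.+1%:R * m ^+ k * (y - m) ^+ 2).
  by rewrite !exprS; ring.
have m_gt0 : 0 < m by rewrite lt_def mN0.
rewrite oppr_ge0 pmulr_rle0 ?mulr_gt0 ?exprn_gt0 ?ltr0n // => ym.
by apply/eqP; rewrite -subr_eq0 -sqrf_eq0 eq_le ym sqr_ge0.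
Qed.

(** Sum the tangent bounds at the mean: the linear terms cancel. *)
Lemma power_mean (I : finType) (A : {pred I}) (E : I -> R) k :
  (forall i, 0 <= E i) ->
  (\sum_(i in A) E i) ^+ k.+1 <= #|A|%:R ^+ k * \sum_(i in A) E i ^+ k.+1.
Proof.
move=> E0; set S := \sum_(i in A) E i; set N : R := #|A|%:R.
have [A0|A_gt0] := posnP #|A|.
  rewrite /S big_pred0 ?expr0n ?mulr_ge0 ?exprn_ge0 ?sumr_ge0 // => [i _|i].
    exact: exprn_ge0.
  by apply: (card0_eq A0).
have N0 : N != 0 by rewrite pnatr_eq0 -lt0n.
have mE : N * (S / N) = S by rewrite mulrCA divff ?mulr1.
have m0 : 0 <= S / N by rewrite divr_ge0 ?sumr_ge0.
rewrite -mE; set m := S / N in mE m0 *.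
rewrite exprMn [N ^+ k.+1]exprSr -mulrA ler_wpM2l ?exprn_ge0 ?ler0n //.
have : \sum_(i in A) (m ^+ k.+1 + k.+1%:R * m ^+ k * (E i - m)) <=
    \sum_(i in A) E i ^+ k.+1.
  by apply: ler_sum => i _; apply: expr_tangent_le.
rewrite big_split /= -mulr_sumr sumrB !sumr_const -/S -[m *+ _]mulr_natl mE.
by rewrite subrr mulr0 addr0 -mulr_natl.
Qed.

End PowerMean.

(** * Products of integers with a prescribed sum *)

Section Balanced.

(** The ratio [c] is chosen so that the increment has the factor [q - m] and vanishes at [m = q]. *)
Local Lemma weight_step (q m : nat) (c := q%:R / q.+1%:R : rat) :
  m.+1%:R * c ^+ m.+1 - m%:R * c ^+ m = c ^+ m * (q%:R - m%:R) / q.+1%:R.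
Proof.
have q0 : (q.+1%:R : rat) != 0 by rewrite pnatr_eq0.
rewrite exprS; set e := c ^+ m; rewrite /c.
move: q0; rewrite -!natr1 => q0; by field.
Qed.

(* [m |-> m * (q / (q + 1)) ^ m] increases up to [q], is flat from [q] to
   [q + 1], and decreases afterwards. *)
Local Lemma weight_max (q m : nat) (c := q%:R / q.+1%:R : rat) : (0 < q)%N ->
  m%:R * c ^+ m <= q%:R * c ^+ q ?= iff (m == q) || (m == q.+1).
Proof.
move=> q0; pose h m : rat := m%:R * c ^+ m; rewrite -/(h m) -/(h q).
have c0 : 0 < c by rewrite divr_gt0 ?ltr0n.
have hE k : h k.+1 - h k = c ^+ k * (q%:R - k%:R) / q.+1%:R := weight_step q k.
have up k : (k < q)%N -> h k < h k.+1.
  by move=> kq; rewrite -subr_gt0 hE divr_gt0 ?ltr0n // mulr_gt0 ?exprn_gt0 // subr_gt0 ltr_nat.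
have down k : (q < k)%N -> h k.+1 < h k.
  move=> kq; rewrite -subr_lt0 hE pmulr_llt0 ?invr_gt0 ?ltr0n // pmulr_rlt0 ?exprn_gt0 //.
  by rewrite subr_lt0 ltr_nat.
have flat : h q.+1 = h q by apply/eqP; rewrite -subr_eq0 hE subrr mulr0 mul0r.
have up_lt d : forall k, (k + d.+1)%N = q -> h k < h q.
  elim: d => [|d IHd] k kq; first by rewrite -[in h q]kq addn1 up // -kq addn1.
  apply: lt_trans (IHd k.+1 _); first by rewrite up // -kq addnS ltnS leq_addr.
  by rewrite addSnnS.
have down_lt d : h (q + d.+2)%N < h q.
  elim: d => [|d]; first by rewrite -[ltRHS]flat !addnS addn0 down.
  by apply: lt_trans; rewrite addnS down // -[ltnLHS]addn0 ltn_add2l.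
have lt_h : (m != q) && (m != q.+1) -> h m < h q.
  case: (ltngtP m q) => // [mq _|qm /= mq1].
    by apply: (up_lt (q - m.+1)%N); rewrite -addSnnS subnKC.
  have {}qm : (q.+1 < m)%N by rewrite ltn_neqAle eq_sym mq1.
  by have := down_lt (m - q.+2)%N; rewrite -!addSnnS subnKC.
apply/leifP; case: ifP => [/orP [] /eqP ->|]; rewrite -/(h _) ?flat //.
by move/negbT; rewrite negb_or; exact: lt_h.
Qed.

(** As the sums agree, attaching [c ^+ m] to each factor [m] multiplies both products by the same
    power of [c]. The comparison then holds factor by factor, by [weight_max]. *)
Lemma prod_balanced (I : finType) (a b : I -> nat) q : (0 < q)%N ->
  (forall i, b i = q \/ b i = q.+1) -> (\sum_i a i = \sum_i b i)%N ->
  (\prod_i a i <= \prod_i b i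
   ?= iff [forall i, (a i == q) || (a i == q.+1)])%N.
Proof.
move=> q0 bq sab; pose c : rat := q%:R / q.+1%:R.
have c0 : 0 < c by rewrite divr_gt0 ?ltr0n.
pose h m : rat := m%:R * c ^+ m.
have prod_h (f : I -> nat) :
    \prod_i h (f i) = (\prod_i f i)%:R * c ^+ (\sum_i f i).
  rewrite big_split /= natr_prod; congr (_ * _).
  by rewrite (big_morph _ (exprD c) (expr0 c)).
have hb i : h (b i) = h q.
  apply/eqP; rewrite (weight_max (b i) q0).
  by case: (bq i) => ->; rewrite eqxx ?orbT.
have := @leif_pprod _ _ xpredT (fun i => (a i == q) || (a i == q.+1))
  (fun i => h (a i)) (fun i => h (b i)).
move=> /(_ (fun i _ => mulr_ge0 (ler0n _ _) (exprn_ge0 _ (ltW c0)))).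
have ha i (_ : true) : h (a i) <= h (b i) ?= iff (a i == q) || (a i == q.+1).
  by rewrite hb; exact: weight_max.
move=> /(_ ha) /=; rewrite !prod_h sab.
rewrite [_ == 0]gt_eqF ?mulr_gt0 ?exprn_gt0 // ?ltr0n ?prodn_gt0 // => [|i]; last first.
  by case: (bq i) => ->.
rewrite /Order.leif ler_pM2r ?exprn_gt0 // ler_nat.
by rewrite (inj_eq (mulIf (expf_neq0 _ (lt0r_neq0 c0)))) eqr_nat.
Qed.
End Balanced.

(** The value tuples of [f] and [g] have equal multiplicities, so one is a permutation of the
    other. *)
Lemma fiber_perm n (T : eqType) (f g : 'I_n -> T) :
  (forall k, #|[pred i | f i == k]| = #|[pred i | g i == k]|) ->
  exists s : {perm 'I_n}, forall i, f i = g (s i).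
Proof.
move=> fg.
have : perm_eq [tuple f i | i < n] [tuple g i | i < n].
  have cnt (h : 'I_n -> T) k : count_mem k [tuple h i | i < n] = #|[pred i | h i == k]|.
    by rewrite !count_map cardE /enum_mem size_filter; apply: eq_count => i.
  by apply/allP => k _; rewrite /= -!/(count_mem _ _) !cnt fg.
case/tuple_permP => s /val_inj fgs; exists s => i.
by have := congr1 (fun t : n.-tuple T => tnth t i) fgs; rewrite !tnth_mktuple.
Qed.

(* Two partitions into [r] classes of sizes [q] and [q + 1] have the same number
   of classes of size [q + 1], so their classes can be matched by size. *)
Lemma balanced_perm n r q (f g : 'I_n -> 'I_r) :
  (forall k, #|[pred i | f i == k]| = q \/ #|[pred i | f i == k]| = q.+1) ->
  (forall k, #|[pred i | g i == k]| = q \/ #|[pred i | g i == k]| = q.+1) ->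
  exists s : {perm 'I_n}, forall u v, (f u == f v) = (g (s u) == g (s v)).
Proof.
move=> fq gq.
pose big (h : 'I_n -> 'I_r) k := #|[pred i | h i == k]| == q.+1.
have sumE (h : 'I_n -> 'I_r) :
    (forall k, #|[pred i | h i == k]| = q \/ #|[pred i | h i == k]| = q.+1) ->
    n = (r * q + #|[pred k | big h k]|)%N.
  move=> hq; rewrite -[LHS]card_ord -sum1_card (partition_big h xpredT) //=.
  transitivity (\sum_(k < r) (q + big h k))%N.
    apply: eq_bigr => k _; rewrite sum1_card /big.
    by case: (hq k) => ->; rewrite ?eqxx ?addn1 // ltn_eqF ?addn0.
  rewrite big_split /= sum_nat_const card_ord; congr (_ + _)%N.
  by rewrite -sum1_card [RHS]big_mkcond; apply: eq_bigr => k _; rewrite inE; case: (big h k).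
have bigE : #|[pred k | big f k]| = #|[pred k | big g k]|.
  by apply/eqP; rewrite -(eqn_add2l (r * q)) -sumE // -sumE.
have [|t tE] := @fiber_perm r bool (big f) (big g).
  case.
    by transitivity #|[pred k | big f k]|; [|rewrite bigE];
      apply: eq_card => k; rewrite !inE eqb_id.
  apply/eqP; rewrite -(eqn_add2l #|[pred k | big f k]|).
  have cpl (h : 'I_n -> 'I_r) : (#|[pred k | big h k]| + #|[pred k | big h k == false]|)%N = r.
    rewrite -[RHS]card_ord -[RHS](cardC [pred k | big h k]); congr (_ + _)%N.
    by apply: eq_card => k; rewrite !inE eqbF_neg.
  by rewrite cpl bigE cpl.
(* Once [t] has matched the classes by size, [t \o f] and [g] have fibers of equal size. *)
have [|s sE] := @fiber_perm n 'I_r (t \o f) g.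
  move=> k; transitivity #|[pred i | f i == (t^-1)%g k]|.
    by apply: eq_card => i; rewrite !inE /= -{1}[k](permKV t) (inj_eq perm_inj).
  have := tE ((t^-1)%g k); rewrite permKV /big.
  case: (fq ((t^-1)%g k)) => ->; case: (gq k) => -> //; rewrite ?eqxx.
    by rewrite ltn_eqF.
  by move=> /esym; rewrite ltn_eqF.
by exists s => u v; rewrite -!sE /= (inj_eq perm_inj).
Qed.

(** * The clique spectral radius as a maximum *)

Lemma rmorph_clique_sum (F F' : comNzRingType) (f : {rmorphism F -> F'}) n
    (G : sgraph n) (x : 'I_n -> F) t A :
  f (clique_sum G x t A) = clique_sum G (f \o x) t A.
Proof. by rewrite rmorph_sum; apply: eq_bigr => S _; rewrite rmorph_prod. Qed.

Lemma norm_clique_sum_le (F : numDomainType) n (G : sgraph n) (x : 'I_n -> F) t A :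
  `|clique_sum G x t A| <= clique_sum G (fun i => `|x i|) t A.
Proof.
apply: le_trans (ler_norm_sum _ _ _) _; apply: ler_sum => S _.
by rewrite normr_prod.
Qed.

(** By cardinality, such a tuple is an ordering of [S] without repetition. *)
Lemma card_tuples_of_set (T : finType) t (S : {set T}) : #|S| = t ->
  #|[set s : t.-tuple T | [set j in s] == S]| = t`!.
Proof.
move=> St; rewrite -[RHS]ffactnn -[X in X ^_ _]St -card_uniq_tuples.
apply: eq_card => s; rewrite !inE; apply/eqP/andP => [sS|[/allP sS us]].
  split; first by apply/allP => j js; change (j \in S); rewrite -sS inE.
  by apply/card_uniqP; rewrite size_tuple -[RHS]St -sS; apply: eq_card => j; rewrite inE.
apply/eqP; rewrite eqEcard; apply/andP; split.
  by apply/subsetP => j; rewrite inE => /sS.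
rewrite St -[X in (X <= _)%N](size_tuple s) -(card_uniqP us).
by apply: subset_leq_card; apply/subsetP => j; rewrite inE.
Qed.

(** The [t]! orderings of a clique of the link cancel the normalization of the tensor. *)
Lemma tensor_apply_clique (R : realType) n t (G : sgraph n) (x : 'cV[R[i]]_n) i :
  tensor_apply (clique_tensor R t.+1 G) x i 0 =
  clique_sum G (fun j => x j 0) t (nbrs G i).
Proof.
rewrite mxE /clique_tensor /=.
transitivity (\sum_(s : t.-tuple 'I_n | [set j in i :: s] \in cliques t.+1 G)
    (t`!%:R^-1 * \prod_(j <- s) x j 0)).
  by rewrite [RHS]big_mkcond; apply: eq_bigr => s _; case: ifP; rewrite ?mul0r.
rewrite /clique_sum.
have cardS (s : t.-tuple 'I_n) : (#|[set j in s]| <= t)%N.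
  by rewrite cardsE -[X in (_ <= X)%N](size_tuple s) card_size.
(* A tuple containing [i] adds no new vertex to reach [t.+1], so it contributes nothing. *)
have cliqueE (s : t.-tuple 'I_n) : ([set j in i :: s] \in cliques t.+1 G) =
    ([set j in s] \in cliques t G) && ([set j in s] \subset nbrs G i).
  have -> : [set j in i :: s] = i |: [set j in s] by apply/setP => j; rewrite !inE.
  case: (boolP (i \in [set j in s])) => is_; last exact: cliqueU1E.
  rewrite (setUidPr _) ?sub1set //; apply/idP/andP => [/clique_card sE|[_ /sub_nbrs_notin]].
    by have := cardS s; rewrite sE ltnn.
  by rewrite is_.
rewrite (eq_bigl _ _ cliqueE).
rewrite (partition_big (fun s : t.-tuple 'I_n => [set j in s])
  (fun S => (S \in cliques t G) && (S \subset nbrs G i))) //=.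
apply: eq_bigr => S SG.
transitivity (\sum_(s in [set s : t.-tuple 'I_n | [set j in s] == S])
    (t`!%:R^-1 * \prod_(j in S) x j 0)).
  apply: eq_big => s; first by rewrite inE; case: eqP => [->|]; rewrite ?SG ?andbF.
  move=> /andP [_ /eqP sS]; congr (_ * _).
  have us : uniq s.
    apply/card_uniqP; rewrite size_tuple -cardsE sS.
    by case/andP: SG => /clique_card.
  by rewrite big_uniq //= -sS; apply: eq_bigl => j; rewrite inE.
rewrite sumr_const card_tuples_of_set; last by case/andP: SG => /clique_card.
by rewrite -mulrnAl -[_ *+ t`!]mulr_natl divff ?mul1r // pnatr_eq0 -lt0n fact_gt0.
Qed.

Lemma exists_root (R : realType) (a : R) k : 0 <= a ->
  exists2 z, 0 <= z & z ^+ k.+1 = a.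
Proof.
move=> a0; exists (powR a k.+1%:R^-1); first exact: powR_ge0.
by rewrite -powR_mulrn ?powR_ge0 // -powRrM mulVf ?pnatr_eq0 // powRr1.
Qed.

(* The bound is sharp only at the minimizer [w] of [z |-> M z^(k+2) - a z],
   where [w^(k+1) = a / ((k+2) M)]; this covers boundary points [x0 = 0] too. *)
Lemma stationary (R : realType) (a M x0 : R) k : 0 <= a -> 0 <= M -> 0 <= x0 ->
  (forall z, 0 <= z -> (z - x0) * a <= M * (z ^+ k.+2 - x0 ^+ k.+2)) ->
  a = k.+2%:R * M * x0 ^+ k.+1.
Proof.
move=> a0; rewrite le_eqVlt => /predU1P [<-|M0] x00 H.
  (* For [M = 0], the test point [x0 + 1] gives [a <= 0]. *)
  apply/le_anti; rewrite mulr0 mul0r a0 andbT.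
  by have := H (x0 + 1); rewrite addrAC subrr add0r mul1r mul0r; apply; rewrite addr_ge0.
have kM0 : 0 < k.+2%:R * M by rewrite mulr_gt0 ?ltr0n.
have [w w0 wE] := exists_root k (divr_ge0 a0 (ltW kM0)).
have aE : a = k.+2%:R * M * w ^+ k.+1 by rewrite wE mulrC divfK ?gt_eqF.
suff -> : x0 = w by [].
(* At [z = w] the hypothesis is the reversed tangent bound at [w]. *)
apply: (expr_tangent_eq x00 w0 (k := k)); apply/le_anti.
rewrite expr_tangent_le // andbT -(ler_pM2l M0) -subr_ge0.
have := H w w0; rewrite -subr_ge0 aE; congr (0 <= _); ring.
Qed.

(** * Existence of a maximizing weight *)

Section Maximizer.
Import numFieldNormedType.Exports.
Local Open Scope classical_set_scope.

(** Compactness gives a maximizer under the normalization; homogeneity extends the bound to all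
    [z >= 0]. *)
Lemma clique_sum_maximizer (R : realType) n (G : sgraph n) t : (0 < n)%N ->
  exists x : 'I_n -> R, [/\ forall i, 0 <= x i, \sum_i x i ^+ t.+1 = 1 &
    forall z : 'I_n -> R, (forall i, 0 <= z i) ->
      clique_sum G z t.+1 [set: 'I_n]%SET <=
      clique_sum G x t.+1 [set: 'I_n]%SET * \sum_i z i ^+ t.+1].
Proof.
move=> n0; pose W (x : 'I_n -> R) := clique_sum G x t.+1 [set: 'I_n]%SET.
pose s (x : 'I_n -> R) := \sum_i x i ^+ t.+1.
(* Nonnegative coordinates with power sum 1 lie in the unit interval anyway; the box supplies
   compactness. *)
pose K := [set v : 'rV[R]_n | forall i, `[0, 1]%classic (v ord0 i)] `&`
  (fun v : 'rV[R]_n => s (v ord0)) @^-1` [set y | y = 1].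
have coord i : continuous (fun v : 'rV[R]_n => v ord0 i) by exact: coord_continuous.
have s_cont : continuous (fun v : 'rV[R]_n => s (v ord0)).
  apply: continuous_big => [|i _]; first exact: add_continuous.
  move=> v; apply: (@continuous_comp _ _ _ _ (fun y : R => y ^+ t.+1)); first exact: coord.
  exact: exprn_continuous.
have W_cont : continuous (fun v : 'rV[R]_n => W (v ord0)).
  apply: continuous_big => [|S _]; first exact: add_continuous.
  by apply: continuous_big => [|i _]; [exact: mul_continuous|exact: coord].
have K_compact : compact K.
  apply: compact_closedI.
    by apply: (@rV_compact R n (fun=> `[0, 1])) => i; exact: segment_compact.
  apply: preimage_closed; last exact: closed_eq.
  by move=> v _; exact: s_cont.
have s_ge0 z : (forall i, 0 <= z i) -> 0 <= s z.
  by move=> z0; apply: sumr_ge0 => i _; apply: exprn_ge0.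
have KP (z : 'I_n -> R) : (forall i, 0 <= z i) -> s z = 1 ->
    K (\row_i z i).
  move=> z0 sz; split=> [i /=|].
    rewrite mxE in_itv /= z0 -(expr_le1 (n := t.+1)) // -sz /s (bigD1 i) //= lerDl.
    by apply: sumr_ge0 => j _; apply: exprn_ge0.
  by rewrite /= -sz; apply: eq_bigr => i _; rewrite mxE.
have row_eq (z : 'I_n -> R) : W ((\row_i z i) ord0) = W z.
  by apply: eq_clique_sum => i _; rewrite mxE.
have K0 : K !=set0.
  exists (\row_i (i == Ordinal n0)%:R); apply: KP => [i|]; first exact: ler0n.
  rewrite /s (bigD1 (Ordinal n0)) //= ?eqxx expr1n big1 ?addr0 // => i /negPf ->.
  by rewrite expr0n.
have [c /set_mem [cK cs] cmax] := compact_EVT_max K0 K_compact (continuous_subspaceT W_cont).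
exists (c ord0); split=> [i|//|z z0].
  by have := cK i; rewrite /= in_itv /= => /andP [].
rewrite -/(W z) -/(W _) -/(s z).
have := s_ge0 z z0; rewrite le_eqVlt => /predU1P [sz0|sz_gt0].
  have zi i : z i = 0.
    have /eqP := esym sz0; rewrite /s psumr_eq0 => [|j _]; last exact: exprn_ge0.
    by move=> /allP /(_ i (mem_index_enum _)); rewrite /= expf_eq0 => /eqP.
  rewrite -sz0 mulr0 /W /clique_sum big1 // => S /andP [/clique_card St _].
  have /card_gt0P [j jS] : (0 < #|S|)%N by rewrite St.
  by rewrite (bigD1 j) //= zi mul0r.
have [m m0 mE] := exists_root t (ltW sz_gt0).
have m_gt0 : 0 < m.
  by rewrite lt_def m0 andbT; apply: contraTneq sz_gt0 => m_0; rewrite -mE m_0 expr0n ltxx.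
have /KP : forall i, 0 <= z i / m by move=> i; rewrite divr_ge0.
have -> : s (fun i => z i / m) = 1.
  rewrite /s; under eq_bigr => i _ do rewrite expr_div_n mE.
  by rewrite -mulr_suml divff ?gt_eqF.
move=> /(_ erefl) /mem_set /cmax; rewrite row_eq.
suff -> : W (fun i => z i / m) = W z / s z by rewrite ler_pdivrMr.
rewrite /W /clique_sum mulr_suml; apply: eq_bigr => S /andP [/clique_card St _].
by rewrite prodf_div prodr_const St mE.
Qed.

End Maximizer.

(** * Variational form of the spectral radius *)

Section SpectralRadius.
Variables (R : realType) (n : nat) (G : sgraph n) (t : nat).

(** Pass to the moduli [y] of an eigenvector: the triangle inequality bounds [rho * y i ^+ t.+1] by
    the link sum. Multiplying by [y i] and summing, Euler's identity concludes. *)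
Lemma clique_eigenvalue_le (mu : R) (lambda : R[i]) (rho : R) :
  (forall z : 'I_n -> R, (forall i, 0 <= z i) ->
     t.+2%:R * clique_sum G z t.+2 [set: 'I_n] <= mu * \sum_i z i ^+ t.+2) ->
  tensor_eigenvalue (clique_tensor R t.+2 G) lambda ->
  `|lambda| = real_complex R rho -> rho <= mu.
Proof.
move=> mu_max [v v0 Av] lambda_rho.
pose y i : R := complex.Re `|v i 0|.
have yE i : real_complex R (y i) = `|v i 0| by rewrite /y RRe_real ?normr_real.
have y0 i : 0 <= y i by rewrite -ler0c yE normr_ge0.
have rho_le i : rho * y i ^+ t.+1 <= clique_sum G y t.+1 (nbrs G i).
  rewrite -lecR rmorph_clique_sum rmorphM rmorphXn /= yE -lambda_rho -normrX -normrM.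
  have := congr1 (fun w : 'cV_n => w i 0) Av; rewrite tensor_apply_clique mxE /= => <-.
  apply: le_trans (norm_clique_sum_le _ _ _ _) _.
  by rewrite le_eqVlt; apply/orP; left; apply/eqP; apply: eq_clique_sum => j _ /=.
have sy : 0 < \sum_i y i ^+ t.+2.
  have [i vi] : exists i, v i 0 != 0.
    apply/existsP; apply: contraNT v0; rewrite negb_exists => /forallP v0.
    by apply/eqP/matrixP => i j; rewrite ord1 mxE; apply/eqP; have := v0 i; rewrite negbK.
  rewrite (bigD1 i) //= ltr_pwDl ?sumr_ge0 // => [|j _]; last exact: exprn_ge0.
  by rewrite exprn_gt0 // -ltcR yE normr_gt0.
rewrite -(ler_pM2r sy); apply: le_trans (mu_max y y0).
rewrite -clique_sum_euler mulr_sumr; apply: ler_sum => i _.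
by rewrite exprS mulrCA ler_wpM2l.
Qed.

(** Stationarity of the maximizer in each coordinate is the eigenvalue equation, and
    [clique_eigenvalue_le] excludes larger moduli. *)
Lemma clique_spectral_radius_max : (0 < n)%N ->
  exists x : 'I_n -> R, [/\ forall i, 0 <= x i, \sum_i x i ^+ t.+2 = 1,
    clique_spectral_radius R t.+2 G = t.+2%:R * clique_sum G x t.+2 [set: 'I_n] &
    forall z : 'I_n -> R, (forall i, 0 <= z i) ->
      t.+2%:R * clique_sum G z t.+2 [set: 'I_n] <=
      clique_spectral_radius R t.+2 G * \sum_i z i ^+ t.+2].
Proof.
move=> n0; have [x [x0 sx xmax]] := @clique_sum_maximizer R n G t.+1 n0.
set M := clique_sum G x t.+2 [set: 'I_n] in xmax.
have M0 : 0 <= M by apply: clique_sum_ge0.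
have mu_max (z : 'I_n -> R) : (forall i, 0 <= z i) ->
    t.+2%:R * clique_sum G z t.+2 [set: 'I_n] <= t.+2%:R * M * \sum_i z i ^+ t.+2.
  by move=> z0; rewrite -mulrA ler_pM2l ?ltr0n // xmax.
suff rhoE : clique_spectral_radius R t.+2 G = t.+2%:R * M.
  by exists x; split=> // z z0; rewrite rhoE mu_max.
(* Only coordinate [i] is varied; the cliques avoiding [i] cancel, leaving the hypothesis of
   [stationary]. *)
have eigen i : clique_sum G x t.+1 (nbrs G i) = t.+2%:R * M * x i ^+ t.+1.
  apply: stationary => // [|z z0]; first exact: clique_sum_ge0.
  pose y j := if j == i then z else x j.
  have y0 j : 0 <= y j by rewrite /y; case: ifP.
  have := xmax y y0; rewrite (clique_sum_split G y t.+1 (u := i)) ?inE // setTI.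
  have -> : clique_sum G y t.+1 (nbrs G i) = clique_sum G x t.+1 (nbrs G i).
    apply: eq_clique_sum => j; rewrite inE /y; case: eqP => // ->.
    by rewrite adj_irrefl.
  have -> : clique_sum G y t.+2 ([set: 'I_n] :\ i) = clique_sum G x t.+2 ([set: 'I_n] :\ i).
    by apply: eq_clique_sum => j; rewrite !inE /y => /andP [/negPf ->].
  have -> : \sum_j y j ^+ t.+2 = z ^+ t.+2 + (1 - x i ^+ t.+2).
    rewrite -sx (bigD1 i) //= [in RHS](bigD1 i) //= /y eqxx addrAC subrr add0r; congr (_ + _).
    by apply: eq_bigr => j /negPf ->.
  have ME : M = x i * clique_sum G x t.+1 (nbrs G i) + clique_sum G x t.+2 ([set: 'I_n] :\ i).
    by rewrite /M (clique_sum_split G x t.+1 (u := i)) ?inE // setTI.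
  have -> : y i = z by rewrite /y eqxx.
  rewrite -subr_ge0 => h; rewrite -subr_ge0; apply: le_trans h _.
  by rewrite mulrDr (mulrBr M 1) mulr1 [X in _ + (X - _)]ME; lra.
have rM0 : 0 <= t.+2%:R * M by rewrite mulr_ge0 ?ler0n.
have mem : eigenvalue_moduli (clique_tensor R t.+2 G) (t.+2%:R * M).
  exists (real_complex R (t.+2%:R * M)); last by rewrite ger0_norm // ler0c.
  exists (\col_i real_complex R (x i)).
    apply: contraTneq (oner_neq0 R) => x_eq0; rewrite -sx big1 ?eqxx // => i _.
    have := congr1 (fun w : 'cV_n => w i 0) x_eq0; rewrite !mxE => /complexI ->.
    by rewrite expr0n.
  apply/matrixP => i j; rewrite ord1 tensor_apply_clique !mxE -rmorphXn -rmorphM /=.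
  rewrite -eigen rmorph_clique_sum; apply: eq_clique_sum => k _.
  by rewrite mxE.
have ub : ubound (eigenvalue_moduli (clique_tensor R t.+2 G)) (t.+2%:R * M).
  by move=> rho [lambda ev lrho]; apply: clique_eigenvalue_le ev lrho.
(* A maximum is unique, so [xget] returns this value and not its default 0. *)
apply: xget_unique => [//|rho [rho_mem rho_ub]].
by apply/le_anti; rewrite ub // rho_ub.
Qed.

End SpectralRadius.

(** * Turán graphs *)

Lemma clique_sum_isomorphism (F : comNzRingType) n (G H : sgraph n)
    (s : {perm 'I_n}) (x : 'I_n -> F) t :
  (forall u v, G u v = H (s u) (s v)) ->
  clique_sum H x t [set: 'I_n] = clique_sum G (x \o s) t [set: 'I_n].
Proof.
move=> GH; rewrite /clique_sum (reindex_inj (imset_inj (@perm_inj _ s))) /=.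
apply: eq_big => S; last by move=> _; rewrite big_imset //= => u v _ _; apply: perm_inj.
rewrite !subsetT !andbT; apply/cliqueP/cliqueP => -[St SG]; split.
- by rewrite -St card_imset //; exact: perm_inj.
- move=> u v uS vS uv; rewrite GH SG ?imset_f //.
  by rewrite (inj_eq perm_inj).
- by rewrite card_imset //; exact: perm_inj.
- move=> _ _ /imsetP [u uS ->] /imsetP [v vS ->]; rewrite (inj_eq perm_inj) -GH.
  exact: SG.
Qed.

Lemma isomorphic_sym n (G H : sgraph n) : isomorphic G H -> isomorphic H G.
Proof. by case=> s GH; exists (s^-1)%g => u v; rewrite GH !permKV. Qed.

Lemma clique_spectral_radius_isomorphic_le (R : realType) n t (G H : sgraph n) :
  (0 < n)%N -> isomorphic G H ->
  clique_spectral_radius R t.+2 G <= clique_spectral_radius R t.+2 H.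
Proof.
move=> n0 /isomorphic_sym [s GH].
have [x [x0 sx -> _]] := clique_spectral_radius_max R G t n0.
have [_ [_ _ _ /(_ (x \o s))]] := clique_spectral_radius_max R H t n0.
rewrite -(clique_sum_isomorphism x t.+2 GH).
move=> /(_ (fun i => x0 _)); congr (_ <= _).
by rewrite -[RHS]mulr1 -sx [in RHS](reindex_inj (@perm_inj _ s)).
Qed.

(** Choosing one vertex in each of the classes below [r] always yields an [r]-clique. *)
Lemma clique_sum_multipartite_ge (R : realFieldType) n (p : 'I_n -> nat)
    (x : 'I_n -> R) r : (forall i, 0 <= x i) ->
  \prod_(k < r) \sum_(i | p i == k) x i <=
  clique_sum (complete_multipartite p) x r [set i | (p i < r)%N].
Proof.
move=> x0; set G := complete_multipartite p; elim: r => [|r IHr].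
  rewrite big_ord0 /clique_sum (bigD1 finset.set0) /=; last first.
    by rewrite sub0set andbT; apply/cliqueP; split=> [|u v]; rewrite ?cards0 // inE.
  by rewrite big_set0 lerDl sumr_ge0 // => S _; apply: prodr_ge0.
set A := [set i | _].
have UA : [set i | p i == r] \subset A.
  by apply/subsetP => i; rewrite !inE => /eqP ->.
apply: (@le_trans _ _ (\sum_(u in [set i | p i == r])
    x u * clique_sum G x r (A :&: nbrs G u))).
  rewrite [leRHS](eq_bigr (fun u =>
      x u * clique_sum G x r [set i | (p i < r)%N])) => [|u]; last first.
    rewrite inE => /eqP pu; congr (_ * clique_sum _ _ _ _).
    by apply/setP => i; rewrite !inE /= pu ltnS leq_eqVlt; case: ltngtP.
  rewrite -mulr_suml big_ord_recr /= mulrC.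
  rewrite [X in X * _](_ : _ = \sum_(u in [set i | p i == r]) x u); last first.
    by apply: eq_bigl => i; rewrite inE.
  by rewrite ler_wpM2l // sumr_ge0.
(* A clique meets the independent class [r] at most once. *)
rewrite clique_sum_double_count //; apply: ler_sum => S /andP [SG SA].
rewrite -[leRHS]mul1r ler_wpM2r ?prodr_ge0 // -[1](mulr1n) ler_nat.
apply/card_le1_eqP => u v; rewrite !inE => /andP [uS /eqP pu] /andP [vS /eqP pv].
apply/eqP; apply: contraT => uv; have [_ /(_ u v uS vS)] := cliqueP _ _ _ SG.
by rewrite eq_sym uv /= pu pv eqxx => /(_ isT).
Qed.

(** Zero weights contribute to neither sum, so the power mean inequality needs to count only the
    support. This sharper count is what later forces all weights to be positive. *)
Lemma prod_part_sums_le (R : realFieldType) n t (P : 'I_n -> 'I_t.+1) (x : 'I_n -> R) :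
  (forall i, 0 <= x i) ->
  (t.+1%:R * \prod_k \sum_(i | P i == k) x i) ^+ t.+1 <=
  (\prod_k #|[pred i | (P i == k) && (0 < x i)%R]|)%:R ^+ t *
    (\sum_i x i ^+ t.+1) ^+ t.+1.
Proof.
move=> x0; pose N k := #|[pred i | (P i == k) && (0 < x i)]|.
pose s k := \sum_(i | P i == k) x i ^+ t.+1.
have s0 k : 0 <= s k by apply: sumr_ge0 => i _; apply: exprn_ge0.
have supp k (f : R -> R) : f 0 = 0 ->
    \sum_(i | P i == k) f (x i) = \sum_(i in [pred i | (P i == k) && (0 < x i)]) f (x i).
  move=> f0; rewrite (bigID (fun i => 0 < x i)) /= [X in _ + X]big1 ?addr0 //.
  move=> i /andP [_]; rewrite lt_def x0 andbT negbK => /eqP ->.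
  exact: f0.
have part_le k : (\sum_(i | P i == k) x i) ^+ t.+1 <= (N k)%:R ^+ t * s k.
  rewrite /s (supp k id) // (supp k (fun y => y ^+ t.+1)) ?expr0n //.
  exact: power_mean.
have sum_s : \sum_k s k = \sum_i x i ^+ t.+1.
  by rewrite [RHS](partition_big P xpredT).
have amgm : t.+1%:R ^+ t.+1 * \prod_k s k <= (\sum_i x i ^+ t.+1) ^+ t.+1.
  have [|+ _] := @leif_AGM_scaled R 'I_t.+1 xpredT s.
    by move=> k _; rewrite mulrn_wge0.
  rewrite sum_s cardT size_enum_ord; apply: le_trans.
  rewrite [leRHS](eq_bigr (fun k => t.+1%:R * s k)) => [|k _]; last by rewrite mulr_natl.
  by rewrite big_split /= prodr_const card_ord.
rewrite exprMn -prodrXl; apply: le_trans (_ : t.+1%:R ^+ t.+1 *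
  \prod_k ((N k)%:R ^+ t * s k) <= _).
  rewrite ler_wpM2l ?exprn_ge0 ?ler0n //; apply: ler_prod => k _.
  by rewrite part_le exprn_ge0 // sumr_ge0.
rewrite big_split /= prodrXl -natr_prod mulrCA ler_wpM2l //.
by rewrite exprn_ge0 ?ler0n.
Qed.

Lemma turan_radius_ge (R : realType) n t : (t.+2 <= n)%N ->
  (\prod_(k < t.+2) #|[set i : 'I_n | (i %% t.+2 == k)%N]|)%:R ^+ t.+1 <=
  clique_spectral_radius R t.+2 (turan n t.+2) ^+ t.+2.
Proof.
move=> tn; have n0 : (0 < n)%N by apply: leq_trans tn.
pose T (k : 'I_t.+2) := #|[set i : 'I_n | (i %% t.+2 == k)%N]|.
have T0 k : 0 < (T k)%:R :> R by rewrite ltr0n turan_part_gt0.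
have part_lt (i : 'I_n) : (i %% t.+2 < t.+2)%N by rewrite ltn_mod.
pose p (i : 'I_n) := Ordinal (part_lt i).
have pT (f : 'I_t.+2 -> R) (k : 'I_t.+2) :
    \sum_(i : 'I_n | (i %% t.+2 == k)%N) f (p i) = (T k)%:R * f k.
  rewrite (eq_bigr (fun=> f k)) => [|i /eqP ik]; last by congr f; apply: val_inj.
  by rewrite mulr_natl -sumr_const; apply: eq_bigl => i; rewrite inE.
(* These weights give every class power sum 1, the equality case of AM-GM across the classes. *)
have [z zP] : exists z : 'I_t.+2 -> R,
    forall k, 0 <= z k /\ z k ^+ t.+2 = (T k)%:R^-1.
  have root k : {y : R | 0 <= y /\ y ^+ t.+2 = (T k)%:R^-1}.
    apply: cid; have [|y y0 yE] := @exists_root R (T k)%:R^-1 t.+1; last by exists y.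
    by rewrite invr_ge0 ler0n.
  by exists (fun k => sval (root k)) => k; exact: svalP (root k).
have [_ [_ _ _ /(_ (z \o p) (fun i => (zP (p i)).1))]] :=
  clique_spectral_radius_max R (turan n t.+2) t n0.
have -> : \sum_i (z \o p) i ^+ t.+2 = t.+2%:R.
  rewrite (partition_big p xpredT) //= (eq_bigr (fun=> 1)) => [|k _].
    by rewrite sumr_const card_ord.
  by rewrite (pT (fun k => z k ^+ t.+2)) (zP k).2 divff ?gt_eqF.
rewrite mulrC ler_pM2r ?ltr0n // => rho_ge.
have := @clique_sum_multipartite_ge R n (fun i : 'I_n => i %% t.+2)%N (z \o p) t.+2
  (fun i => (zP (p i)).1).
have -> : [set i : 'I_n | (i %% t.+2 < t.+2)%N] = [set: 'I_n].
  by apply/setP => i; rewrite !inE part_lt.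
move=> /le_trans /(_ rho_ge) {}rho_ge.
rewrite (eq_bigr (fun k : 'I_t.+2 => (T k)%:R * z k)) in rho_ge; last by move=> k _; rewrite pT.
apply: (@le_trans _ _ ((\prod_(k < t.+2) ((T k)%:R * z k)) ^+ t.+2)); last first.
  have Tz0 : 0 <= \prod_(k < t.+2) ((T k)%:R * z k).
    by apply: prodr_ge0 => k _; rewrite mulr_ge0 ?ler0n ?(zP k).1.
  by rewrite lerXn2r ?nnegrE // (le_trans Tz0).
(* By the choice of [z], each factor [(T k)%:R * z k] has [t.+2]-th power [(T k)%:R ^+ t.+1]. *)
rewrite natr_prod -!prodrXl le_eqVlt; apply/orP; left; apply/eqP.
by apply: eq_bigr => k _; rewrite exprMn (zP k).2 [in RHS]exprSr mulfK ?gt_eqF ?T0.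
Qed.

(** * The spectral Turán bound and its extremal graph *)

Theorem theorem1p3 (R : realType) (r n : nat) (hr : (2 <= r)%N) (hn : (r <= n)%N)
    (G : sgraph n) (hG : clique_free r.+1 G) :
  clique_spectral_radius R r G <= clique_spectral_radius R r (turan n r) /\
  (clique_spectral_radius R r G = clique_spectral_radius R r (turan n r) <->
   isomorphic G (turan n r)).
Proof.
case: r hr hn hG => [|[|t]] // _ hn hG.
have n0 : (0 < n)%N by apply: leq_trans hn.
have [x [x0 sx rhoE _]] := clique_spectral_radius_max R G t n0.
set W := clique_sum G x t.+2 _ in rhoE.
have [|p [p_lt Wp eqW]] := @erdos_partition R n G x t.+2 [set: 'I_n] x0.
  by move=> S SG; move: SG; rewrite hG inE.
(* All labels are below [t.+2], so [inord] preserves them. *)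
pose P i : 'I_t.+2 := inord (p i).
have PE i (k : 'I_t.+2) : (p i == k) = (P i == k).
  by rewrite -val_eqE /= inordK // p_lt ?inE.
have partsE : \prod_(k < t.+2) \sum_(i in [set: 'I_n] | p i == k) x i =
    \prod_k \sum_(i | P i == k) x i.
  by apply: eq_bigr => k _; apply: eq_bigl => i; rewrite inE PE.
rewrite {}partsE -/W in Wp eqW; set Q := \prod_k _ in Wp eqW.
pose N k := #|[pred i | (P i == k) && (0 < x i)]|.
pose M k := #|[pred i | P i == k]|.
pose T (k : 'I_t.+2) := #|[set i : 'I_n | (i %% t.+2 == k)%N]|.
pose q := (n %/ t.+2)%N.
have q0 : (0 < q)%N by rewrite divn_gt0.
have Tq k : T k = q \/ T k = q.+1.
  by rewrite /T turan_partE //; case: (_ < _)%N; rewrite ?addn1 ?addn0; [right|left].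
have part_lt (i : 'I_n) : (i %% t.+2 < t.+2)%N by rewrite ltn_mod.
pose g (i : 'I_n) := Ordinal (part_lt i).
have gT k : #|[pred i | g i == k]| = T k by apply: eq_card => i; rewrite !inE.
have sum_fibers (h : 'I_n -> 'I_t.+2) : (\sum_k #|[pred i | h i == k]| = n)%N.
  rewrite -[RHS]card_ord -sum1_card (partition_big h xpredT) //=.
  by apply: eq_bigr => k _; rewrite sum1_card.
have sumMT : (\sum_k M k = \sum_k T k)%N.
  by rewrite sum_fibers -(sum_fibers g); apply: eq_bigr => k _; rewrite gT.
have [MT MT_eq] := prod_balanced q0 Tq sumMT.
have NM k : (N k <= M k)%N.
  by apply: subset_leq_card; apply/subsetP => i; rewrite !inE => /andP [].
have NM_prod : (\prod_k N k <= \prod_k M k)%N by apply: leq_prod.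
have W0 : 0 <= W by apply: clique_sum_ge0.
(* The next four facts form one chain from the radius of [G] to that of the Turán graph, both raised
   to the power [t.+2]. *)
have rho_le : clique_spectral_radius R t.+2 G ^+ t.+2 <= (t.+2%:R * Q) ^+ t.+2.
  by rewrite rhoE lerXn2r ?nnegrE ?mulr_ge0 ?ler0n ?(le_trans W0) // ler_pM2l ?ltr0n.
have Q_le : (t.+2%:R * Q) ^+ t.+2 <= (\prod_k N k)%:R ^+ t.+1.
  by have := prod_part_sums_le P x0; rewrite sx expr1n mulr1.
have N_le : (\prod_k N k)%:R ^+ t.+1 <= (\prod_k T k)%:R ^+ t.+1 :> R.
  by rewrite lerXn2r ?nnegrE ?ler0n // ler_nat (leq_trans NM_prod).
have T_le : (\prod_k T k)%:R ^+ t.+1 <= clique_spectral_radius R t.+2 (turan n t.+2) ^+ t.+2.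
  exact: turan_radius_ge.
have rho0 (H : sgraph n) : 0 <= clique_spectral_radius R t.+2 H.
  have [y [y0 _ -> _]] := clique_spectral_radius_max R H t n0.
  by rewrite mulr_ge0 ?ler0n ?clique_sum_ge0.
split.
  rewrite -(ler_pXn2r (n := t.+2)) ?nnegrE //.
  exact: le_trans rho_le (le_trans Q_le (le_trans N_le T_le)).
split=> [rho_eq|iso]; last first.
  by apply/le_anti; rewrite !clique_spectral_radius_isomorphic_le //; exact: isomorphic_sym.
have T0 : (0 < \prod_k T k)%N.
  by apply: prodn_gt0 => k; apply: turan_part_gt0.
rewrite -rho_eq in T_le.
(* Equal radii close the chain, so all its terms coincide. *)
have NT : (\prod_k N k = \prod_k T k)%N.
  apply/eqP; rewrite -(eqr_nat R) -(eqrXn2 (n := t.+1)) ?ler0n // eq_le N_le.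
  exact: le_trans T_le (le_trans rho_le Q_le).
have NM_eq : (\prod_k N k = \prod_k M k)%N.
  by apply/eqP; rewrite eqn_leq NM_prod NT MT.
have Mq k : M k = q \/ M k = q.+1.
  move: MT_eq; rewrite -NM_eq NT eqxx => /esym /forallP /(_ k).
  by case/orP => /eqP; [left|right].
(* A vertex of weight 0 would make [N] smaller than [M] on its class; the other classes have size at
   least [q > 0], so the product would drop. *)
have x_gt0 i : 0 < x i.
  apply: contraT => xi; suff : (\prod_k N k < \prod_k M k)%N by rewrite NM_eq ltnn.
  rewrite (bigD1 (P i)) // [ltnRHS](bigD1 (P i)) //=.
  apply: (@leq_ltn_trans (N (P i) * \prod_(k | k != P i) M k)%N).
    by rewrite leq_mul2l leq_prod ?orbT.
  rewrite ltn_pmul2r; last by apply: prodn_gt0 => k; case: (Mq k) => ->.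
  apply: proper_card; apply/properP; split.
    by apply/subsetP => j; rewrite !inE => /andP [].
  by exists i; rewrite !inE eqxx.
have WQ : W = Q.
  apply/eqP; rewrite eq_le Wp /= -(ler_pM2l (ltr0Sn R t.+1)) -rhoE.
  rewrite -(ler_pXn2r (n := t.+2)) ?nnegrE ?rho0 ?mulr_ge0 ?ler0n ?(le_trans W0) //.
  exact: le_trans Q_le (le_trans N_le T_le).
have W_gt0 : 0 < W.
  rewrite lt_def W0 andbT; apply: contraTneq T_le => W_eq0.
  by rewrite rhoE W_eq0 mulr0 expr0n -ltNge exprn_gt0 // ltr0n.
have Gp := eqW x_gt0 W_gt0 WQ.
(* Both partitions have classes of sizes [q] and [q.+1] only. *)
have [s sE] : exists s : {perm 'I_n}, forall u v, (P u == P v) = (g (s u) == g (s v)).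
  by apply: (@balanced_perm n t.+2 q) => [|k]; [exact: Mq|rewrite gT].
exists s => u v; rewrite /= Gp ?inE //.
by move: (sE u v); rewrite -PE -!val_eqE /= inordK ?p_lt ?inE // => ->.
Qed.
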